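(* Let $a$ be a positive real number and $k\in\mathbb{N}$, and assume the integrals below converge. Then \[ \lim_{k\to\infty}\int_{[0,\infty)^{2k}}\frac{\cos\left(\sum_{n=1}^{2k}(-1)^{n+1}x_n\right)}{\sum_{n=1}^k\frac{x_{2n}}{a+n-1}+\sum_{n=1}^k\frac{x_{2n-1}}{a+n-1}}\prod_{n=1}^{2k}dx_n=\frac{1}{2}\sqrt{\pi}\,\frac{\Gamma\left(a+\frac12\right)}{\Gamma(a)}, \] and, for every $k\in\mathbb{N}$, \[ \int_{[0,\infty)^{2k}}\frac{\sin\left(\sum_{n=1}^{2k}(-1)^{n+1}x_n\right)}{\sum_{n=1}^k\frac{x_{2n}}{a+n-1}+\sum_{n=1}^k\frac{x_{2n-1}}{a+n-1}}\prod_{n=1}^{2k}dx_n=0. \]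
   Context: $\Gamma$ denotes Euler's gamma function. *)

(* Defs.v *)
From HB Require Import structures.
From mathcomp Require Import all_boot all_order all_algebra.
From mathcomp Require Import all_classical all_reals all_analysis.
Set Implicit Arguments. Unset Strict Implicit. Unset Printing Implicit Defensive.
Import Order.TTheory GRing.Theory Num.Theory.
Import numFieldNormedType.Exports.
Local Open Scope classical_set_scope.
Local Open Scope ring_scope.

Definition Gamma {R : realType} (s : R) : R :=
  Rintegral (@lebesgue_measure R) `[0, +oo[%classic
            (fun t => t `^ (s - 1) * expR (- t)).

(* Iterated Lebesgue integral over the box [0,L]^n of f : seq R -> R.
   The list argument [x_1; ...; x_n] collects the coordinates; x_1 is the
   outermost integration variable. *)
Fixpoint box_int {R : realType} (n : nat) (L : R) (f : seq R -> R) : R :=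
  match n with
  | 0 => f [::]
  | n'.+1 => Rintegral (@lebesgue_measure R) `[0, L]%classic
               (fun x => box_int n' L (fun xs => f (x :: xs)))
  end.

(* The coordinate x_(i+1) of the point xs (0-based index i). *)
Definition coord {R : realType} (xs : seq R) (i : nat) : R := nth 0 xs i.

Definition alt_sum {R : realType} (k : nat) (xs : seq R) : R :=
  \sum_(i < 2 * k) (-1) ^+ i * coord xs i.

Definition wdenom {R : realType} (a : R) (k : nat) (xs : seq R) : R :=
  \sum_(n < k) coord xs (2 * n + 1) / (a + n%:R)
  + \sum_(n < k) coord xs (2 * n) / (a + n%:R).

Definition cos_integrand {R : realType} (a : R) (k : nat) (xs : seq R) : R :=
  cos (alt_sum k xs) / wdenom a k xs.

Definition sin_integrand {R : realType} (a : R) (k : nat) (xs : seq R) : R :=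
  sin (alt_sum k xs) / wdenom a k xs.

(* Main.v *)
(** Writing 1/D as the integral of exp(-tD) over t >= 0 and exchanging the
    integrals, the box integral becomes the integral over t of a product of
    one-variable integrals of exp(+-ix - tx/(a+n)); each pair of conjugate
    factors gives a squared modulus. Hence the integrand in t is real, which
    kills the sine integral, and by dominated convergence the cosine integral
    tends to J_k = int_0^oo prod_(n<k) (1 + t^2/(a+n)^2)^-1 dt.

    With P_k(a) = prod_(n<k) (t^2 + (a+n)^2)^-1 one has
    P_k(a) - P_k(a+1) = k (2a + k) P_(k+1)(a), so the integrals of P_k follow by
    induction on k from that of P_1. In terms of r(x) = Gamma(x+1/2)/Gamma(x)
    this reads J_(k+1) = pi/2 r(a) r(1/2) (a+k) / (r(a+k) r(k+1/2)), and
    the bounds x^2/(x+1/2) <= r(x)^2 <= x together with Gamma(1/2) = sqrt pi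
    give the limit. *)
Require Import Defs.
From HB Require Import structures.
From mathcomp Require Import all_boot all_order all_algebra.
From mathcomp Require Import all_classical all_reals all_analysis.
From mathcomp Require Import measurable_realfun ring lra.
Set Implicit Arguments.
Unset Strict Implicit.
Unset Printing Implicit Defensive.
Import Order.TTheory GRing.Theory Num.Theory.
Import numFieldNormedType.Exports.
Local Open Scope classical_set_scope.
Local Open Scope ring_scope.

(** * Integrability of linear combinations of real-valued functions *)

Section integrable_EFin.
Context d (T : measurableType d) (R : realType).
Variables (mu : {measure set T -> \bar R}) (D : set T) (mD : measurable D).
Implicit Types f g : T -> R.

Lemma integrable_EFinZl k f : mu.-integrable D (EFin \o f) ->
  mu.-integrable D (EFin \o (fun t => k * f t)).
Proof. by move=> /(integrableZl mD k); exact: eq_integrable. Qed.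

Lemma integrable_EFinD f g :
  mu.-integrable D (EFin \o f) -> mu.-integrable D (EFin \o g) ->
  mu.-integrable D (EFin \o (fun t => f t + g t)).
Proof.
by move=> fi gi; have := integrableD mD fi gi; exact: eq_integrable.
Qed.

End integrable_EFin.

(** * Calculus: antiderivatives on compact and unbounded intervals, exhaustion of the half-line,
    exponentials *)

Section calculus.
Context {R : realType}.
Notation mu := (@lebesgue_measure R).
Implicit Types (f F : R -> R) (a b : R).

Lemma integral_itvcc_is_derive f F a b : a < b ->
  {in `[a, b], forall x : R, is_derive x 1 F (f x)} ->
  {in `[a, b], continuous f} ->
  (\int[mu]_(x in `[a, b]) (f x)%:E = (F b - F a)%:E)%E.
Proof.
move=> ab dF cf.
have dF1 x : x \in `[a, b] -> derivable F x 1 by move=> /dF[].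
rewrite (@continuous_FTC2 _ f F) //.
- by apply: continuous_in_subspaceT => x /set_mem/= xab; exact: cf.
- have cF x : x \in `[a, b] -> {for x, continuous F}.
    by move=> xab; apply/differentiable_continuous/derivable1_diffP/dF1.
  split.
  + by move=> x /= xab; exact/dF1/subset_itv_oo_cc.
  + by apply/cvg_at_right_filter/cF; rewrite in_itv/= lexx ltW.
  + by apply/cvg_at_left_filter/cF; rewrite in_itv/= lexx ltW.
- move=> x xab; rewrite derive1E; have := dF x (subset_itv_oo_cc xab).
  by case.
Qed.

Lemma integral_itvcy_is_derive f F a (l : R) :
  (forall x, a <= x -> 0 <= f x) ->
  (forall x : R, a <= x -> is_derive x 1 F (f x)) ->
  (forall x, a <= x -> {for x, continuous f}) ->
  F x @[x --> +oo] --> l ->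
  (\int[mu]_(x in `[a, +oo[) (f x)%:E = (l - F a)%:E)%E.
Proof.
move=> f0 dF cf Fl.
rewrite (@ge0_continuous_FTC2y _ f F a l) //.
- apply: continuous_in_subspaceT => x /set_mem/=.
  by rewrite in_itv/= andbT; exact: cf.
- by move=> x /ltW/dF[].
- apply: cvg_at_right_filter.
  apply: differentiable_continuous; apply/derivable1_diffP.
  by case: (dF a (lexx a)).
- move=> x; rewrite in_itv/= andbT => /ltW/dF[_].
  by rewrite derive1E.
Qed.

(** Monotone convergence along an exhaustion by compact intervals. It lets integrands that are
    singular at 0 be handled on intervals where they are continuous. *)
Lemma ge0_cvg_integral_itvcc f (u v : R^nat) :
  (forall n, 0 < u n) ->
  nonincreasing_seq u -> u @ \oo --> (0 : R) ->
  nondecreasing_seq v -> v @ \oo --> +oo ->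
  (forall x, 0 < x -> 0 <= f x) -> measurable_fun (`]0, +oo[ : set R) f ->
  (\int[mu]_(x in `[u n, v n]) (f x)%:E @[n --> \oo] -->
   \int[mu]_(x in `]0%R, +oo[) (f x)%:E)%E.
Proof.
move=> u0 du cu dv cv f0 mf.
have -> : `]0, +oo[%classic = \bigcup_n `[u n, v n]%classic.
  apply/seteqP; split => x /=; rewrite ?in_itv/= ?andbT.
    move=> x0.
    have : \forall n \near \oo, u n <= x /\ x <= v n.
      near=> n; split.
        near: n; exact: (cvgr_le _ cu).
      near: n; by move/cvgryPge : cv; exact.
    case=> N _ /(_ N (leqnn N)) [uN vN].
    by exists N => //=; rewrite in_itv/= uN.
  case=> n _ /=; rewrite in_itv/= => /andP[+ _].
  exact: lt_le_trans.
apply: ge0_nondecreasing_set_cvg_integral => //.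
- move=> m n mn; apply/subsetPset => x /=.
  rewrite !in_itv/= => /andP[h1 h2]; apply/andP; split.
    by apply: le_trans h1; exact: du.
  by apply: (le_trans h2); exact: dv.
- move=> n; apply/measurable_EFinP; apply: measurable_funS mf => //.
  move=> x /=; rewrite !in_itv/= andbT => /andP[+ _].
  exact: lt_le_trans.
- move=> n x /=; rewrite in_itv/= lee_fin => /andP[+ _] => h.
  by apply: f0; exact: lt_le_trans h.
Unshelve. all: by end_near. Qed.

Lemma measurable_expRN c (D : set R) : measurable_fun D (fun t => expR (- (c * t))).
Proof.
apply: measurable_funTS; apply: measurableT_comp => //.
by apply: measurable_funN; exact: measurable_funM.
Qed.

Lemma measurable_funZl_expRN (k c : R) (D : set R) :
  measurable_fun D (fun t => k * expR (- (c * t))).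
Proof. by apply: measurable_funM => //; exact: measurable_expRN. Qed.

Lemma integral_expRN c : 0 < c ->
  (\int[mu]_(t in `[0%R, +oo[) (expR (- (c * t)))%:E = (c^-1)%:E)%E.
Proof.
move=> c0; pose F t := - (c^-1 * expR (- (c * t))).
have dF (x : R) : 0 <= x -> is_derive x 1 F (expR (- (c * x))).
  move=> _; apply: is_derive_eq.
  by rewrite /GRing.scale/=; field; exact: lt0r_neq0.
rewrite (@integral_itvcy_is_derive _ F 0 0)//.
- by rewrite /F mulr0 oppr0 expR0 mulr1 sub0r opprK.
- by move=> x _; apply/differentiable_continuous/derivable1_diffP/ex_derive.
- rewrite -[X in _ --> X]oppr0; apply: cvgN.
  rewrite -[X in _ --> X](mulr0 c^-1); apply: cvgM; first exact: cvg_cst.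
  apply: (cvg_comp (fun t : R => c * t) (fun x => expR (- x))).
    by apply: gt0_cvgMry => //; exact: cvg_id.
  exact: cvgr_expR.
Qed.

End calculus.

(** * Fubini's theorem for iterated real-valued integrals *)

Section Rintegral_Fubini.
Context d1 d2 (T1 : measurableType d1) (T2 : measurableType d2) (R : realType).
Variable m1 : {sigma_finite_measure set T1 -> \bar R}.
Variable m2 : {sigma_finite_measure set T2 -> \bar R}.
Variables (D1 : set T1) (D2 : set T2) (f : T1 * T2 -> R) (g : T2 -> R).
Hypotheses (mD1 : measurable D1) (mD2 : measurable D2).
Hypothesis mf : measurable_fun setT f.
Hypothesis ig : m2.-integrable D2 (EFin \o g).
Hypothesis fg : forall y, D2 y ->
  (\int[m1]_(x in D1) (`|f (x, y)|)%:E <= (g y)%:E)%E.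

(** Extension by zero turns integrals over [D1] and [D2] into integrals over the full spaces. *)
Let h : T1 * T2 -> \bar R := (EFin \o f) \_ (D1 `*` D2).

Let hE x y : h (x, y) = if (x \in D1) && (y \in D2) then (f (x, y))%:E else 0%E.
Proof.
rewrite /h patchE; congr (if _ then _ else _); apply/idP/andP.
  by rewrite inE => -[/= ? ?]; rewrite !inE.
by rewrite !inE => -[].
Qed.

Let mh : measurable_fun setT h.
Proof.
apply/(measurable_restrictT _ (measurableX mD1 mD2)).
by apply: measurable_funTS; exact/measurable_EFinP.
Qed.

Let int1 x : (\int[m2]_y h (x, y))%E =
  ((fun x => \int[m2]_(y in D2) (f (x, y))%:E) \_ D1)%E x.
Proof.
rewrite patchE; case: ifPn => xD; last first.
  by under eq_integral do rewrite hE (negbTE xD)/=; rewrite integral0.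
rewrite [RHS]integral_mkcond; apply: eq_integral => y _.
by rewrite hE xD patchE.
Qed.

Let int2 y : (\int[m1]_x h (x, y))%E =
  ((fun y => \int[m1]_(x in D1) (f (x, y))%:E) \_ D2)%E y.
Proof.
rewrite patchE; case: ifPn => yD; last first.
  by under eq_integral do rewrite hE (negbTE yD) andbF/=; rewrite integral0.
rewrite [RHS]integral_mkcond; apply: eq_integral => x _.
by rewrite hE yD andbT patchE.
Qed.

(** Tonelli's criterion, with the integral over [x] inside: [fg] bounds the inner integral of the
    absolute value by the integrable [g]. *)
Let ih : (m1 \x m2)%E.-integrable setT h.
Proof.
apply/integrable21ltyP => //.
apply: (@le_lt_trans _ _ (\int[m2]_y ((EFin \o g) \_ D2) y)%E); last first.
  rewrite -integral_mkcond.
  by have /integrable_fin_num := ig => /(_ mD2); rewrite fin_numE => /andP[_]; rewrite ltey.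
have g0 y : D2 y -> (0 <= (g y)%:E)%E.
  by move=> /fg; apply: le_trans; apply: integral_ge0 => x _; rewrite lee_fin.
apply: ge0_le_integral => //.
- by move=> y _; apply: integral_ge0.
- apply: (measurable_fun_fubini_tonelli_G (abse \o h)) => //=.
  exact: measurableT_comp.
- apply/(measurable_restrictT _ mD2); exact: measurable_int ig.
- move=> y _; rewrite patchE; case: ifPn => yD; last first.
    by under eq_integral do rewrite hE (negbTE yD) andbF/= normr0; rewrite integral0.
  apply: le_trans (fg (set_mem yD)).
  rewrite [leRHS]integral_mkcond le_eqVlt; apply/orP; left; apply/eqP.
  apply: eq_integral => x _.
  by rewrite hE yD andbT patchE; case: ifPn => //= _; rewrite normr0.
Qed.

Lemma measurable_Rintegral2 : measurable_fun D1 (fun x => \int[m2]_(y in D2) f (x, y)).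
Proof.
have := measurable_fubini_F ih => mF.
have : measurable_fun D1 (fine \o fubini_F m2 h).
  by apply: measurableT_comp => //; exact: measurable_funTS.
apply: eq_measurable_fun => x xD /=.
by rewrite /fubini_F int1 patchE xD.
Qed.

(** [fine] sends an infinite inner integral to 0, so the real-valued inner integrals agree with the
    extended ones only where the sections are integrable. This holds almost everywhere, which is
    enough for the outer integrals. *)
Lemma Rintegral_Fubini :
  \int[m1]_(x in D1) \int[m2]_(y in D2) f (x, y) =
  \int[m2]_(y in D2) \int[m1]_(x in D1) f (x, y).
Proof.
rewrite [LHS]Rintegral_mkcond [RHS]Rintegral_mkcond /Rintegral.
transitivity (fine (\int[m1]_x \int[m2]_y h (x, y))%E); last first.
  rewrite (Fubini ih); congr fine.
  apply: ae_eq_integral => //.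
  - exact: (measurable_fubini_G ih).
  - rewrite (_ : (fun _ => _) = EFin \o (fine \o fubini_G m1 h)).
      apply/measurable_EFinP; apply: measurableT_comp => //.
      exact: (measurable_fubini_G ih).
    by apply/funext => y /=; rewrite /fubini_G int2 !patchE; case: ifPn.
  - have := ae_integrable2 ih; apply: filterS => y iy _.
    have := integrable_fin_num measurableT iy; rewrite int2 !patchE.
    by case: ifPn => // _ /fineK ->.
congr fine; apply/esym; apply: ae_eq_integral => //.
- exact: (measurable_fubini_F ih).
- rewrite (_ : (fun _ => _) = EFin \o (fine \o fubini_F m2 h)).
    apply/measurable_EFinP; apply: measurableT_comp => //.
    exact: (measurable_fubini_F ih).
  by apply/funext => y /=; rewrite /fubini_F int1 !patchE; case: ifPn.
- have := ae_integrable1 ih; apply: filterS => x ix _.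
  have := integrable_fin_num measurableT ix; rewrite int1 !patchE.
  by case: ifPn => // _ /fineK ->.
Qed.

End Rintegral_Fubini.

(** * The gamma function: recurrence, positivity, a half-step inequality, the value at 1/2 *)

Section gamma.
Context {R : realType}.
Notation mu := (@lebesgue_measure R).
Implicit Types s t x : R.

Definition gamma_kernel s t : R := t `^ (s - 1) * expR (- t).

(** Extended-real valued, so that the recurrence can be proved before finiteness is known. The open
    ray avoids the singularity of the kernel at 0. *)
Definition gamma_integral s : \bar R :=
  (\int[mu]_(t in `]0%R, +oo[) (gamma_kernel s t)%:E)%E.

Lemma gamma_kernel_ge0 s t : 0 <= gamma_kernel s t.
Proof. by rewrite mulr_ge0 ?powR_ge0 ?expR_ge0. Qed.

Lemma measurable_gamma_kernel s (D : set R) :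
  measurable_fun D (gamma_kernel s).
Proof.
apply: measurable_funTS; apply: measurable_funM; first exact: measurable_powR.
by apply: measurableT_comp => //; exact: measurable_funN.
Qed.

Lemma gamma_integral_ge0 s : (0 <= gamma_integral s)%E.
Proof. by apply: integral_ge0 => t _; rewrite lee_fin gamma_kernel_ge0. Qed.

Lemma GammaE s : Gamma s = \int[mu]_(t in `]0, +oo[) gamma_kernel s t.
Proof.
rewrite /Rintegral integral_itv_obnd_cbnd//.
by apply/measurable_EFinP; exact: measurable_gamma_kernel.
Qed.

(** Take logarithms and use [ln y < y] at [y = t / (2 * s)]: this gives s ln (t / (2 s)) < t / 2. *)
Lemma powR_expRN_le s t : 0 < s -> 0 < t ->
  t `^ s * expR (- t) <= (2 * s) `^ s * expR (- (t / 2)).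
Proof.
move=> s0 t0.
have s20 : 0 < 2 * s by rewrite mulr_gt0.
rewrite /powR !gt_eqF// -!expRD ler_expR.
have : ln (t / (2 * s)) < t / (2 * s) by apply: ln_sublinear; rewrite divr_gt0.
rewrite ln_div// => h.
have : s * (ln t - ln (2 * s)) < s * (t / (2 * s)) by rewrite ltr_pM2l.
have -> : s * (t / (2 * s)) = t / 2 by field; rewrite gt_eqF.
lra.
Qed.

Lemma cvgy_powR_expRN s : 0 < s -> t `^ s * expR (- t) @[t --> +oo] --> 0.
Proof.
move=> s0.
apply: (@squeeze_cvgr _ _ _ _ (cst 0)
  (fun t => (2 * s) `^ s * expR (- (t / 2)))).
- near=> t; rewrite mulr_ge0 ?powR_ge0 ?expR_ge0//= powR_expRN_le//.
- exact: cvg_cst.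
- rewrite -[X in _ --> X](mulr0 ((2 * s) `^ s)); apply: cvgM; first exact: cvg_cst.
  apply: (cvg_comp (fun t : R => t / 2) (fun x => expR (- x))).
    by apply: gt0_cvgMly => //; exact: cvg_id.
  exact: cvgr_expR.
Unshelve. all: by end_near. Qed.

Lemma is_derive_gamma_kernel s t : 0 < t ->
  is_derive t 1 (fun t => - gamma_kernel (s + 1) t)
    (gamma_kernel (s + 1) t - s * gamma_kernel s t).
Proof.
move=> t0.
have := @is_derive1_powR R s t t0 => d1.
rewrite /gamma_kernel addrK.
apply: is_derive_eq.
rewrite /GRing.scale/=.
ring.
Qed.

Lemma continuous_gamma_kernel s t : 0 < t ->
  {for t, continuous (gamma_kernel s)}.
Proof.
move=> t0; apply/differentiable_continuous/derivable1_diffP.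
have := @is_derive1_powR R (s - 1) t t0 => d1.
by rewrite /gamma_kernel; apply: ex_derive.
Qed.

(** The shift by 2 ensures [u n < 1 < v n] already at [n = 0]. *)
Let u (n : nat) : R := n.+2%:R^-1.
Let v (n : nat) : R := n.+2%:R.

Let u_gt0 n : 0 < u n. Proof. by rewrite invr_gt0. Qed.

Let nonincreasing_u : nonincreasing_seq u.
Proof. by move=> m n mn; rewrite lef_pV2 ?posrE// ler_nat. Qed.

Let nondecreasing_v : nondecreasing_seq v.
Proof. by move=> m n mn; rewrite ler_nat. Qed.

Let u_lt_v n : u n < v n.
Proof. by rewrite (@lt_trans _ _ 1)// ?invf_lt1// ?ltr1n. Qed.

Let cvg_v : v @ \oo --> +oo.
Proof.
apply/cvgryPge => A; near=> n; apply: (@le_trans _ _ n%:R).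
  by near: n; exact: nbhs_infty_ger.
by rewrite /v ler_nat -addn2 leq_addr.
Unshelve. all: by end_near. Qed.

Let cvg_u : u @ \oo --> (0 : R).
Proof.
apply: (gtr0_cvgV0 _).2 cvg_v.
by apply: nearW => n; rewrite /v.
Qed.

(** Integration by parts on [[u n, v n]], with antiderivative - t^s exp(- t); the boundary terms
    vanish as [n] grows. *)
Lemma gamma_integralS s : 0 < s ->
  (gamma_integral (s + 1) = s%:E * gamma_integral s)%E.
Proof.
move=> s0.
have cg r := @ge0_cvg_integral_itvcc R (gamma_kernel r) u v u_gt0
  nonincreasing_u cvg_u nondecreasing_v cvg_v
  (fun x _ => gamma_kernel_ge0 r x) (@measurable_gamma_kernel r _).
have I n : (\int[mu]_(x in `[u n, v n]) (gamma_kernel (s + 1) x)%:E =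
    s%:E * (\int[mu]_(x in `[u n, v n]) (gamma_kernel s x)%:E) +
    (gamma_kernel (s + 1) (u n) - gamma_kernel (s + 1) (v n))%:E)%E.
  have uv_gt0 x : x \in `[u n, v n] -> 0 < x.
    by rewrite in_itv/= => /andP[+ _]; exact: lt_le_trans.
  have ik r : mu.-integrable `[u n, v n] (EFin \o gamma_kernel r).
    apply: continuous_compact_integrable; first exact: segment_compact.
    apply: continuous_in_subspaceT => x /set_mem/= /uv_gt0.
    exact: continuous_gamma_kernel.
  have iZ : mu.-integrable `[u n, v n] (EFin \o (fun t => s * gamma_kernel s t)).
    exact: integrable_EFinZl.
  rewrite -integralZl//; last exact: (ik s).
  have := @integral_itvcc_is_derive R
    (fun t => gamma_kernel (s + 1) t - s * gamma_kernel s t)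
    (fun t => - gamma_kernel (s + 1) t) _ _ (u_lt_v n).
  rewrite opprK [X in X%:E]addrC => <-.
  - rewrite integralB_EFin//.
    under [X in (_ = X + _)%E]eq_integral do rewrite /= -EFinM.
    by rewrite addeC subeK//; exact: integrable_fin_num.
  - by move=> x /uv_gt0; exact: is_derive_gamma_kernel.
  - move=> x /uv_gt0 x0; apply: cvgB; first exact: continuous_gamma_kernel.
    by apply: cvgM; [exact: cvg_cst|exact: continuous_gamma_kernel].
have := cg (s + 1); rewrite (eq_cvg _ _ I).
rewrite /gamma_integral => /cvg_lim <-//; apply/cvg_lim => //.
rewrite -[X in _ --> X]adde0; apply: cvgeD.
- exact: fin_num_adde_defl.
- by apply: cvgeZl => //; exact: cg.
- apply: cvg_EFin; first exact: nearW.
  rewrite -[X in _ --> X](subr0 0); apply: cvgB; rewrite /gamma_kernel addrK.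
    rewrite -[X in _ --> X](mul0r (expR (- 0))); apply: cvgM.
      have /cvg_at_rightP := powR_cvg0 s0.
      by apply; split.
    apply: (cvg_comp (fun n => - u n) expR); last exact: continuous_expR.
    exact: cvgN.
  have /cvg_pinftyP := cvgy_powR_expRN s0.
  exact.
Qed.

(** The recurrence reduces the claim to [s + 1], where the kernel has no singularity at 0 and is
    dominated by a multiple of exp(- t / 2). *)
Lemma gamma_integral_lty s : 0 < s -> (gamma_integral s < +oo)%E.
Proof.
move=> s0.
suff : (gamma_integral (s + 1) < +oo)%E.
  rewrite gamma_integralS//; have := gamma_integral_ge0 s.
  by case: (gamma_integral s) => [r|//|//] _; rewrite ?ltry// gt0_muley// lte_fin.
apply: (@le_lt_trans _ _ (\int[mu]_(t in `]0%R, +oo[)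
    ((2 * s) `^ s * expR (- (2^-1 * t)))%:E)%E).
  apply: ge0_le_integral => //.
  - by move=> t _; rewrite lee_fin gamma_kernel_ge0.
  - by apply/measurable_EFinP; exact: measurable_gamma_kernel.
  - by apply/measurable_EFinP; exact: measurable_funZl_expRN.
  - move=> t; rewrite /= in_itv/= andbT lee_fin /gamma_kernel addrK => t0.
    by rewrite [2^-1 * t]mulrC powR_expRN_le.
rewrite integral_itv_obnd_cbnd; last first.
  by apply/measurable_EFinP; exact: measurable_funZl_expRN.
under eq_integral do rewrite EFinM.
rewrite ge0_integralZl//.
- by rewrite integral_expRN// -EFinM ltry.
- by apply/measurable_EFinP; exact: measurable_expRN.
- by rewrite lee_fin powR_ge0.
Qed.

Lemma integrable_gamma_kernel s : 0 < s ->
  mu.-integrable `]0, +oo[ (EFin \o gamma_kernel s).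
Proof.
move=> s0; apply/integrableP; split.
  by apply/measurable_EFinP; exact: measurable_gamma_kernel.
under eq_integral do rewrite /= ger0_norm ?gamma_kernel_ge0//.
exact: gamma_integral_lty.
Qed.

Lemma GammaS s : 0 < s -> Gamma (s + 1) = s * Gamma s.
Proof.
move=> s0; rewrite !GammaE /Rintegral -!/(gamma_integral _) gamma_integralS// fineM//.
by rewrite ge0_fin_numE ?gamma_integral_lty ?gamma_integral_ge0.
Qed.

Lemma Gamma1 : Gamma 1 = 1 :> R.
Proof.
rewrite /Gamma /Rintegral.
under eq_integral do rewrite subrr powRr0 mul1r -[X in - X]mul1r.
by rewrite integral_expRN// invr1.
Qed.

Lemma Gamma_gt0 s : 0 < s -> 0 < Gamma s.
Proof.
(* [c] bounds the kernel from below on [1, 2]: there 0 <= ln t <= t <= 2, so (s - 1) ln t >= - 2 |s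
   - 1|, and - t >= - 2. *)
move=> s0; pose c : R := expR (- (`|s - 1| * 2) - 2).
rewrite GammaE fine_gt0// gamma_integral_lty// andbT.
apply: (@lt_le_trans _ _ (\int[mu]_(t in `[1%R, 2%R]) (c)%:E)%E).
  rewrite integral_cst//= lebesgue_measure_itv/= lte_fin ltr1n/= -EFinD -EFinM.
  by rewrite lte_fin mulr_gt0 ?expR_gt0// subr_gt0 ltr1n.
apply: (@le_trans _ _ (\int[mu]_(t in `[1%R, 2%R]) (gamma_kernel s t)%:E)%E).
  apply: ge0_le_integral => //.
  - by move=> t _; rewrite lee_fin expR_ge0.
  - by apply/measurable_EFinP; exact: measurable_gamma_kernel.
  - move=> t; rewrite /= in_itv/= lee_fin => /andP[t1 t2].
    have t0 : 0 < t by rewrite (lt_le_trans _ t1).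
    rewrite /gamma_kernel /powR gt_eqF// -expRD ler_expR lerD ?lerN2//.
    rewrite lerNl (le_trans (ler_norm _))// normrN normrM ler_wpM2l//.
    rewrite ger0_norm ?ln_ge0// (le_trans _ t2)// ltW// ln_sublinear//.
apply: ge0_subset_integral => //.
- by apply/measurable_EFinP; exact: measurable_gamma_kernel.
- by move=> t _; rewrite lee_fin gamma_kernel_ge0.
- by move=> t /=; rewrite !in_itv/= andbT => /andP[t1 _]; rewrite (lt_le_trans _ t1).
Qed.

(* Integrate t^(x-1/2) = t^((x-1)/2) t^(x/2) <= (sqrt x t^(x-1) + t^x / sqrt x) / 2. *)
Lemma GammaDhalf_le x : 0 < x -> Gamma (x + 2^-1) <= Num.sqrt x * Gamma x.
Proof.
move=> x0; have r0 : 0 < Num.sqrt x by rewrite sqrtr_gt0.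
have xh : 0 < x + 2^-1 by rewrite addr_gt0.
have x1 : 0 < x + 1 by rewrite addr_gt0.
have -> : Num.sqrt x * Gamma x =
    Num.sqrt x / 2 * Gamma x + (2 * Num.sqrt x)^-1 * Gamma (x + 1).
  rewrite GammaS//.
  have -> : x * Gamma x = Num.sqrt x ^+ 2 * Gamma x by rewrite sqr_sqrtr ?ltW.
  field.
  by rewrite gt_eqF.
rewrite !GammaE -!RintegralZl//; [|exact: integrable_gamma_kernel..].
rewrite -RintegralD//; [|exact/integrable_EFinZl/integrable_gamma_kernel..].
apply: le_Rintegral => //.
- exact: integrable_gamma_kernel.
- by apply: integrable_EFinD => //; exact/integrable_EFinZl/integrable_gamma_kernel.
- move=> t; rewrite /= in_itv/= andbT /gamma_kernel => t0.
  have tn0 : t != 0 by rewrite gt_eqF.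
  set y := t `^ ((x - 1) / 2) ; set z := t `^ (x / 2).
  have -> : t `^ (x + 2^-1 - 1) = y * z.
    by rewrite -powRD ?tn0 ?implybT//; congr (_ `^ _); field.
  have -> : t `^ (x - 1) = y ^+ 2.
    by rewrite expr2 -powRD ?tn0 ?implybT//; congr (_ `^ _); field.
  have -> : t `^ (x + 1 - 1) = z ^+ 2.
    by rewrite expr2 -powRD ?tn0 ?implybT//; congr (_ `^ _); field.
  have h : y * z <= Num.sqrt x / 2 * y ^+ 2 + (2 * Num.sqrt x)^-1 * z ^+ 2.
    rewrite -subr_ge0 (_ : _ - _ =
      (2 * Num.sqrt x)^-1 * (Num.sqrt x * y - z) ^+ 2).
      by rewrite mulr_ge0 ?sqr_ge0// invr_ge0 mulr_ge0.
    by field; rewrite gt_eqF.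
  by have := ler_wpM2r (expR_ge0 (- t)) h; rewrite mulrDl -!mulrA.
Qed.

(** The substitution t = x^2 turns t^(-1/2) exp(- t) dt into 2 exp(- x^2) dx. Taking [0 < a] keeps
    the kernel continuous on the interval. *)
Lemma integral_gamma_kernel_half (a b : R) : 0 < a -> a < b ->
  (\int[mu]_(x in `[(a ^+ 2)%R, (b ^+ 2)%R]) (gamma_kernel 2^-1 x)%:E =
   2%:E * \int[mu]_(x in `[a, b]) (gauss_fun x)%:E)%E.
Proof.
move=> a0 ab; pose F (x : R) : R := x ^+ 2.
have F' : F^`()%classic = fun x => 2 * x.
  apply/funext => x; rewrite derive1E derive_val/= /GRing.scale/= !mulr1.
  by rewrite mulr_natl.
have cF : continuous F by move=> x; exact: exprn_continuous.
have cF' : continuous (F^`()%classic : R -> R).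
  by rewrite F' => x; apply: cvgM; [exact: cvg_cst|exact: cvg_id].
rewrite (@integration_by_substitution_increasing R F (gamma_kernel 2^-1)) ?ltW//.
- rewrite -ge0_integralZl//.
  + apply: eq_integral => x; rewrite inE/= in_itv/= => /andP[ax _].
    have x0 : 0 < x by exact: lt_le_trans ax.
    rewrite /= F' /gamma_kernel /gauss_fun -EFinM; congr EFin.
    rewrite fctE /=; have -> : F x `^ (2^-1 - 1) = x^-1.
      rewrite /F -(powR_mulrn 2 (ltW x0)) -powRrM -(powR_inv1 (ltW x0)).
      by congr (_ `^ _); field.
    by rewrite /F; field; rewrite gt_eqF.
  + by apply/measurable_EFinP; apply: measurable_funTS; exact: measurable_gauss_fun.
  + by move=> x _; rewrite lee_fin gauss_fun_ge0.
- move=> x y; rewrite !in_itv/= => /andP[ax _] /andP[ay _] xy.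
  by rewrite /F ltr_pXn2r ?nnegrE ?(le_trans (ltW a0)).
- by apply/cvg_ex; exists (F^`()%classic a); exact/cvg_at_right_filter/cF'.
- by apply/cvg_ex; exists (F^`()%classic b); exact/cvg_at_left_filter/cF'.
- split; first by move=> x _; exact: ex_derive.
  + exact/cvg_at_right_filter/cF.
  + exact/cvg_at_left_filter/cF.
- apply: continuous_in_subspaceT => x /set_mem/=; rewrite in_itv/= => /andP[ax _].
  apply: continuous_gamma_kernel; apply: lt_le_trans ax.
  by rewrite exprn_gt0.
Qed.

(** Both sides of the substitution formula are exhausted along [u] and [v], and the Gaussian
    integral over the half-line is sqrt pi / 2. *)
Lemma Gamma_half : Gamma 2^-1 = Num.sqrt pi :> R.
Proof.
have cg : (\int[mu]_(x in `[(u n ^+ 2)%R, (v n ^+ 2)%R]) (gamma_kernel 2^-1 x)%:E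
    @[n --> \oo] --> gamma_integral 2^-1)%E.
  apply: (@ge0_cvg_integral_itvcc R (gamma_kernel 2^-1) (fun n => u n ^+ 2)
    (fun n => v n ^+ 2)).
  - by move=> n; rewrite exprn_gt0.
  - by move=> m n mn; rewrite lerXn2r ?nnegrE ?(ltW (u_gt0 _))//; exact: nonincreasing_u.
  - by rewrite -[X in _ --> X](mulr0 0); apply: cvgM.
  - by move=> m n mn; rewrite lerXn2r ?nnegrE//; exact: nondecreasing_v.
  - by apply: (cvg_comp v (fun x => x ^+ 2) cvg_v); exact: cvgr_expr2.
  - by move=> x _; exact: gamma_kernel_ge0.
  - exact: measurable_gamma_kernel.
have := @ge0_cvg_integral_itvcc R gauss_fun u v u_gt0
  nonincreasing_u cvg_u nondecreasing_v cvg_v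
  (fun x _ => gauss_fun_ge0 x) (measurable_funTS measurable_gauss_fun).
have -> : (\int[mu]_(x in `]0%R, +oo[) (gauss_fun x)%:E)%E = (Num.sqrt pi / 2)%:E.
  rewrite -integral0y_gauss integral_itv_obnd_cbnd//.
  by apply/measurable_EFinP; apply: measurable_funTS; exact: measurable_gauss_fun.
move=> cgauss.
have h : (\int[mu]_(x in `[(u n ^+ 2)%R, (v n ^+ 2)%R]) (gamma_kernel 2^-1 x)%:E
    @[n --> \oo] --> 2%:E * (Num.sqrt pi / 2)%:E)%E.
  rewrite (eq_cvg _ _ (fun n => integral_gamma_kernel_half (u_gt0 n) (u_lt_v n))).
  have := @cvgeZl _ _ R _ _ 2%:E isT cgauss; exact.
have E := cvg_unique (@ereal_hausdorff R) cg h.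
rewrite GammaE /Rintegral -/(gamma_integral _) E -EFinM/=.
by field.
Qed.

End gamma.

(** * The ratio r(x) = Gamma(x + 1/2) / Gamma(x) and its two-sided bounds *)

Section gamma_ratio.
Context {R : realType}.
Implicit Types x : R.

Definition gamma_ratio x : R := Gamma (x + 2^-1) / Gamma x.

Lemma gamma_ratio_gt0 x : 0 < x -> 0 < gamma_ratio x.
Proof. by move=> x0; rewrite divr_gt0// Gamma_gt0// addr_gt0. Qed.

Lemma gamma_ratioS x : 0 < x ->
  gamma_ratio (x + 1) = gamma_ratio x * ((x + 2^-1) / x).
Proof.
move=> x0; rewrite /gamma_ratio addrAC !GammaS ?addr_gt0//.
by field; rewrite ?gt_eqF ?Gamma_gt0.
Qed.

Lemma gamma_ratio_half : gamma_ratio 2^-1 = (Num.sqrt pi)^-1 :> R.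
Proof.
rewrite /gamma_ratio (_ : 2^-1 + 2^-1 = 1 :> R); last by field.
by rewrite Gamma1 Gamma_half div1r.
Qed.

Lemma gamma_ratio_sqr_le x : 0 < x -> gamma_ratio x ^+ 2 <= x.
Proof.
move=> x0; rewrite -[X in _ <= X]sqr_sqrtr ?(ltW x0)//.
rewrite lerXn2r ?nnegrE ?sqrtr_ge0// ?(ltW (gamma_ratio_gt0 x0))//.
by rewrite ler_pdivrMr ?Gamma_gt0// GammaDhalf_le.
Qed.

(** Two half steps make a full one: r(x) r(x + 1/2) = Gamma(x + 1) / Gamma(x) = x. Hence the upper
    bound at x + 1/2 is a lower bound at x. *)
Lemma gamma_ratio_sqr_ge x : 0 < x -> x ^+ 2 / (x + 2^-1) <= gamma_ratio x ^+ 2.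
Proof.
move=> x0; have xh : 0 < x + 2^-1 by rewrite addr_gt0.
have : gamma_ratio x * gamma_ratio (x + 2^-1) = x.
  rewrite /gamma_ratio -addrA (_ : 2^-1 + 2^-1 = 1); last by field.
  by rewrite GammaS//; field; rewrite !gt_eqF ?Gamma_gt0.
move=> xE; rewrite ler_pdivrMr// -{1}xE exprMn ler_pM2l ?exprn_gt0 ?gamma_ratio_gt0//.
exact: gamma_ratio_sqr_le.
Qed.

End gamma_ratio.

(** * Closed form for the integrals of the rational functions P_k *)

Section rational_integral.
Context {R : realType}.
Notation mu := (@lebesgue_measure R).
Implicit Types (a t : R) (k : nat).

Definition prod_invD a k t : R := \prod_(n < k) (t ^+ 2 + (a + n%:R) ^+ 2)^-1.

Let D_gt0 a t (n : nat) : 0 < a -> 0 < t ^+ 2 + (a + n%:R) ^+ 2.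
Proof. by move=> a0; rewrite ltr_wpDl ?sqr_ge0// exprn_gt0// ltr_wpDr. Qed.

Lemma prod_invD_ge0 a k t : 0 < a -> 0 <= prod_invD a k t.
Proof. by move=> a0; apply: prodr_ge0 => i _; rewrite invr_ge0 ltW ?D_gt0. Qed.

Lemma prod_invDSr a k t :
  prod_invD a k.+1 t = prod_invD a k t * (t ^+ 2 + (a + k%:R) ^+ 2)^-1.
Proof. by rewrite /prod_invD big_ord_recr. Qed.

Lemma prod_invDSl a k t :
  prod_invD a k.+1 t = (t ^+ 2 + a ^+ 2)^-1 * prod_invD (a + 1) k t.
Proof.
rewrite /prod_invD big_ord_recl addr0; congr (_ * _).
by apply: eq_bigr => i _; rewrite -addrA nat1r.
Qed.

(** Both products on the left are P_(k+1)(a) with one end factor cancelled. The two cancelled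
    denominators differ by (a + k)^2 - a^2 = k (2 a + k). *)
Lemma prod_invD_sub a k t : 0 < a ->
  prod_invD a k t - prod_invD (a + 1) k t =
  k%:R * (2 * a + k%:R) * prod_invD a k.+1 t.
Proof.
move=> a0.
have e1 : prod_invD a k t = (t ^+ 2 + (a + k%:R) ^+ 2) * prod_invD a k.+1 t.
  by rewrite prod_invDSr mulrCA mulfV ?mulr1// gt_eqF// D_gt0.
have e2 : prod_invD (a + 1) k t = (t ^+ 2 + a ^+ 2) * prod_invD a k.+1 t.
  rewrite prod_invDSl mulrA mulfV ?mul1r// gt_eqF//.
  by have := D_gt0 t 0 a0; rewrite addr0.
by rewrite e1 e2; ring.
Qed.

Lemma continuous_prod_invD a k : 0 < a -> continuous (prod_invD a k).
Proof.
move=> a0; elim: k => [|k IH] x.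
  rewrite (_ : prod_invD a 0 = cst 1); first exact: cvg_cst.
  by apply/funext => t; rewrite /prod_invD big_ord0.
rewrite (_ : prod_invD a k.+1 =
    (fun t => prod_invD a k t * (t ^+ 2 + (a + k%:R) ^+ 2)^-1)); last first.
  by apply/funext => t; rewrite prod_invDSr.
apply: cvgM; first exact: IH.
apply: cvgV; first by rewrite gt_eqF ?D_gt0.
by apply: cvgD; [exact: exprn_continuous|exact: cvg_cst].
Qed.

Lemma measurable_prod_invD a k (D : set R) : 0 < a ->
  measurable_fun D (prod_invD a k).
Proof.
move=> a0; apply: measurable_funTS; apply: continuous_measurable_fun.
exact: continuous_prod_invD.
Qed.

Lemma integral_invD a : 0 < a ->
  (\int[mu]_(t in `[0%R, +oo[) (prod_invD a 1 t)%:E = (pi / (2 * a))%:E)%E.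
Proof.
move=> a0; pose F t := a^-1 * atan (a^-1 * t).
have an0 : a != 0 by rewrite gt_eqF.
have dF (x : R) : 0 <= x -> is_derive x 1 F (prod_invD a 1 x).
  move=> _; apply: is_derive_eq.
  rewrite /prod_invD big_ord_recl big_ord0 addr0/= /GRing.scale/=; field.
  by rewrite an0/= gt_eqF// ltr_wpDl ?sqr_ge0// exprn_gt0.
rewrite (@integral_itvcy_is_derive _ (prod_invD a 1) F 0 (a^-1 * (pi / 2)))//.
- by rewrite /F mulr0 atan0 mulr0 subr0; congr EFin; field.
- by move=> x _; rewrite prod_invD_ge0.
- by move=> x _; exact: continuous_prod_invD.
- apply: cvgM; first exact: cvg_cst.
  apply: (cvg_comp (fun t => a^-1 * t) atan); last exact: cvgy_atan.
  by apply: gt0_cvgMry; rewrite ?invr_gt0//; exact: cvg_id.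
Qed.

(** All factors but the first are largest at [t = 0], which leaves a constant multiple of the
    integrable first factor. *)
Lemma integrable_prod_invD a k : 0 < a ->
  mu.-integrable `[0, +oo[ (EFin \o prod_invD a k.+1).
Proof.
move=> a0; have a1 : 0 < a + 1 by rewrite addr_gt0.
have i1 : mu.-integrable `[0, +oo[ (EFin \o prod_invD a 1).
  apply/integrableP; split.
    by apply/measurable_EFinP; exact: measurable_prod_invD.
  under eq_integral do rewrite /= ger0_norm ?prod_invD_ge0//.
  by rewrite integral_invD// ltry.
have i2 : mu.-integrable `[0, +oo[
    (EFin \o (fun t => prod_invD (a + 1) k 0 * prod_invD a 1 t)).
  exact: integrable_EFinZl.
apply: le_integrable i2 => //.
- by apply/measurable_EFinP; exact: measurable_prod_invD.
- move=> t _; rewrite /= lee_fin !ger0_norm ?prod_invD_ge0//; last first.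
    by rewrite mulr_ge0 ?prod_invD_ge0.
  have -> : prod_invD a 1 t = (t ^+ 2 + a ^+ 2)^-1.
    by rewrite prod_invDSl /prod_invD big_ord0 mulr1.
  rewrite prod_invDSl mulrC ler_wpM2r//.
    by have := D_gt0 t 0 a0; rewrite addr0 invr_ge0 => /ltW.
  apply: ler_prod => i _; rewrite invr_ge0 ltW ?D_gt0//=.
  by rewrite lef_pV2 ?posrE ?D_gt0// lerD2r expr0n/= sqr_ge0.
Qed.

Let f a (j : nat) : R :=
  (2 * j%:R + 1) / ((j%:R + 1) * (a + j%:R + 1) * (2 * a + 2 * j%:R + 1)).

(** The quotient [f (a + 1) j / f a j] is (a + j + 1) (2 a + 2 j + 1) over the same expression at j
    + 1, so the product telescopes. *)
Let prod_f a k : 0 < a ->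
  \prod_(j < k) f (a + 1) j = \prod_(j < k) f a j *
    ((a + 1) * (2 * a + 1) / ((a + k%:R + 1) * (2 * a + 2 * k%:R + 1))).
Proof.
move=> a0; have kp (i : nat) : 0 <= i%:R :> R by [].
elim: k => [|k IH].
  rewrite !big_ord0; field; apply/andP; split; rewrite gt_eqF//; lra.
rewrite !big_ord_recr/= IH /f -[k.+1%:R]natr1; field.
have := kp k; rewrite -?[GRing.natmul _ k]/(k%:R); set x := k%:R => x0.
by do ?(apply/andP; split); rewrite gt_eqF//; lra.
Qed.

(** Induction with [a] general, since the difference identity calls on the parameters [a] and
    [a + 1]. *)
Lemma Rintegral_prod_invD a k : 0 < a ->
  \int[mu]_(t in `[0, +oo[) prod_invD a k.+1 t =
  pi / (2 * a) * \prod_(j < k) ((2 * j%:R + 1) /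
     ((j%:R + 1) * (a + j%:R + 1) * (2 * a + 2 * j%:R + 1))).
Proof.
elim: k a => [|k IH] a a0.
  by rewrite big_ord0 mulr1 /Rintegral integral_invD.
have a1 : 0 < a + 1 by rewrite addr_gt0.
have c0 : 0 < k.+1%:R * (2 * a + k.+1%:R) :> R.
  by rewrite mulr_gt0// addr_gt0// mulr_gt0.
apply: (mulfI (lt0r_neq0 c0)).
rewrite -RintegralZl//; last exact: integrable_prod_invD.
under eq_Rintegral do rewrite -prod_invD_sub//.
rewrite RintegralB//; [|exact: integrable_prod_invD..].
rewrite !IH// big_ord_recr/=.
rewrite -!/(f _ _) prod_f// /f -natr1.
have : 0 <= k%:R :> R by [].
set x : R := k%:R => x0; set p := \prod_(j < k) _.
field.
by do ?(apply/andP; split); rewrite gt_eqF//; lra.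
Qed.

End rational_integral.

(** * The integrals J_k in terms of gamma ratios, and their limit *)

Section gamma_limit.
Context {R : realType}.
Notation mu := (@lebesgue_measure R).
Implicit Types (a t : R) (k : nat).

Definition prod_inv1D a k t : R := \prod_(n < k) (1 + (t / (a + n%:R)) ^+ 2)^-1.

Lemma prod_inv1DE a k t : 0 < a ->
  prod_inv1D a k t = \prod_(n < k) (a + n%:R) ^+ 2 * prod_invD a k t.
Proof.
move=> a0; rewrite -big_split/=; apply: eq_bigr => n _.
have an : 0 < a + n%:R by rewrite ltr_wpDr.
field; rewrite (gt_eqF an)/= !gt_eqF//.
by rewrite ltr_wpDl ?sqr_ge0// exprn_gt0.
Qed.

(** From [k] to [k + 1] both sides gain the factor (a + k + 1) (2 k + 1) / ((k + 1) (2 a + 2 k +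
    1)); on the right it comes from [gamma_ratioS], applied at a + k and at k + 1/2. *)
Lemma Rintegral_prod_inv1D a k : 0 < a ->
  \int[mu]_(t in `[0, +oo[) prod_inv1D a k.+1 t =
  pi / 2 * gamma_ratio a * gamma_ratio 2^-1 *
    ((a + k%:R) / (gamma_ratio (a + k%:R) * gamma_ratio (k%:R + 2^-1))).
Proof.
move=> a0; under eq_Rintegral do rewrite prod_inv1DE//.
rewrite RintegralZl//; last exact: integrable_prod_invD.
rewrite Rintegral_prod_invD//; elim: k => [|k IH].
  rewrite big_ord_recl !big_ord0 !addr0 !add0r; field.
  by rewrite !gt_eqF// gamma_ratio_gt0.
rewrite big_ord_recr/= [X in _ * (_ * X)]big_ord_recr/=.
rewrite [LHS](_ : _ = (\prod_(i < k.+1) (a + i%:R) ^+ 2 * (pi / (2 * a) *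
  \prod_(j < k) ((2 * j%:R + 1) /
     ((j%:R + 1) * (a + j%:R + 1) * (2 * a + 2 * j%:R + 1))))) *
  ((a + k%:R + 1) ^+ 2 * ((2 * k%:R + 1) /
     ((k%:R + 1) * (a + k%:R + 1) * (2 * a + 2 * k%:R + 1))))); last first.
  rewrite -(natr1 k) addrA; set p := \prod_(i < k.+1) _; set q := \prod_(i < k) _.
  set w := (_ + 1) / _; ring.
have h1 : 0 < a + k%:R by rewrite ltr_wpDr.
have h2 : 0 < k%:R + 2^-1 :> R by rewrite ltr_wpDl.
have r1 := gamma_ratio_gt0 h1; have r2 := gamma_ratio_gt0 h2.
rewrite IH -(natr1 k) addrA (addrAC _ 1) (gamma_ratioS h1) (gamma_ratioS h2).
have : 0 <= k%:R :> R by [].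
move: r1 r2; set x : R := k%:R; set g1 := gamma_ratio (a + x).
set g2 := gamma_ratio (x + _).
move=> r1 r2 x0; field.
by do ?(apply/andP; split); rewrite gt_eqF//; lra.
Qed.

Lemma cvg_Rintegral_prod_inv1D a : 0 < a ->
  \int[mu]_(t in `[0, +oo[) prod_inv1D a k.+1 t @[k --> \oo] -->
  2^-1 * Num.sqrt pi * gamma_ratio a.
Proof.
move=> a0.
under eq_fun do rewrite Rintegral_prod_inv1D//.
have -> : 2^-1 * Num.sqrt pi * gamma_ratio a =
    pi / 2 * gamma_ratio a * gamma_ratio 2^-1 * 1.
  have p0 : 0 < Num.sqrt pi :> R by rewrite sqrtr_gt0 pi_gt0.
  rewrite gamma_ratio_half -[X in X / 2]sqr_sqrtr ?pi_ge0//; field.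
  by rewrite gt_eqF.
apply: cvgM; first exact: cvg_cst.
pose X k := a + k%:R; pose Y k : R := k%:R + 2^-1.
have X0 k : 0 < X k by rewrite ltr_wpDr.
have Y0 k : 0 < Y k by rewrite ltr_wpDl.
have cY c : c / Y k @[k --> \oo] --> 0.
  rewrite -[X in _ --> X](mulr0 c); apply: cvgM; first exact: cvg_cst.
  apply: (gtr0_cvgV0 (nearW _ Y0)).2.
  apply/cvgryPge => A; near=> n; apply: (@le_trans _ _ n%:R).
    by near: n; exact: nbhs_infty_ger.
  by rewrite lerDl.
have c1Y c : 1 + c / Y k @[k --> \oo] --> (1 : R).
  by rewrite -[X in _ --> X]addr0; apply: cvgD; [exact: cvg_cst|exact: cY].
(* The bounds on r concern its square. They place X^2 / r(X)^2 between X and X + 1/2, and 1 / r(Y)^2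
   between 1 / Y and (Y + 1/2) / Y^2. With X = Y + a - 1/2 the products of these ends are the two
   squeezing sequences. *)
have csq : ((X k / (gamma_ratio (X k) * gamma_ratio (Y k))) ^+ 2)
    @[k --> \oo] --> (1 : R).
  apply: (@squeeze_cvgr _ _ _ _ (fun k => 1 + (a - 2^-1) / Y k)
    (fun k => (1 + a / Y k) * (1 + 2^-1 / Y k))).
  - apply: nearW => k.
    have gX := gamma_ratio_gt0 (X0 k). have gY := gamma_ratio_gt0 (Y0 k).
    rewrite exprMn exprVn exprMn invfM mulrA.
    have -> : 1 + (a - 2^-1) / Y k = X k * (Y k)^-1.
      by rewrite /X /Y; field; rewrite gt_eqF// (Y0 k).
    have -> : (1 + a / Y k) * (1 + 2^-1 / Y k) =
        (X k + 2^-1) * (Y k ^+ 2 / (Y k + 2^-1))^-1.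
      have : 0 <= k%:R :> R by [].
      rewrite /X /Y; set x : R := k%:R => x0; field.
      by do ?(apply/andP; split); rewrite gt_eqF//; lra.
    have Xg : X k <= X k ^+ 2 / gamma_ratio (X k) ^+ 2 <= X k + 2^-1.
      apply/andP; split.
        rewrite ler_pdivlMr ?exprn_gt0// expr2 (expr2 (X k)) ler_pM2l//.
        by rewrite -expr2 gamma_ratio_sqr_le.
      have := gamma_ratio_sqr_ge (X0 k).
      rewrite ler_pdivrMr ?(addr_gt0 (X0 k))// => h.
      by rewrite ler_pdivrMr ?exprn_gt0// mulrC.
    have Yg : (Y k)^-1 <= (gamma_ratio (Y k) ^+ 2)^-1 <= (Y k ^+ 2 / (Y k + 2^-1))^-1.
      have Y2 : 0 < Y k ^+ 2 / (Y k + 2^-1).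
        by rewrite divr_gt0 ?exprn_gt0 ?(addr_gt0 (Y0 k)).
      have g2 : 0 < gamma_ratio (Y k) ^+ 2 by rewrite exprn_gt0.
      rewrite !lef_pV2 ?posrE//.
      by rewrite gamma_ratio_sqr_le// gamma_ratio_sqr_ge.
    case/andP: Xg => X1 X2; case/andP: Yg => Y1 Y2.
    apply/andP; split.
      by apply: ler_pM X1 Y1; rewrite ?invr_ge0 ltW.
    by apply: ler_pM X2 Y2; rewrite ?divr_ge0 ?invr_ge0 ?sqr_ge0.
  - exact: c1Y.
  - by rewrite -[X in _ --> X](mulr1 1); apply: cvgM; exact: c1Y.
have : Num.sqrt ((X k / (gamma_ratio (X k) * gamma_ratio (Y k))) ^+ 2)
    @[k --> \oo] --> Num.sqrt (1 : R).
  exact: (cvg_comp _ _ csq (@sqrt_continuous _ _)).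
rewrite sqrtr1; apply: cvg_trans; apply: near_eq_cvg; apply: nearW => k /=.
rewrite sqrtr_sqr ger0_norm// ltW// divr_gt0// mulr_gt0//.
  exact: gamma_ratio_gt0.
exact: gamma_ratio_gt0.
Unshelve. all: by end_near. Qed.

End gamma_limit.

(** * Damped oscillatory integrals in one variable, with pairs of reals standing for complex
    numbers *)

Section oscillation.
Context {R : realType}.
Notation mu := (@lebesgue_measure R).
Implicit Types (L s t e w th : R) (c z : R * R) (cs : seq (R * R)).

(* [cosL L s] and [sinL L s] are the integrals over [0, L] of
   [exp (- s x) cos x] and [exp (- s x) sin x]. *)
Definition cosL L s : R :=
  (s + expR (- (s * L)) * (sin L - s * cos L)) / (1 + s ^+ 2).
Definition sinL L s : R :=
  (1 - expR (- (s * L)) * (cos L + s * sin L)) / (1 + s ^+ 2).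

(* The real part of [(z.1 + i z.2) exp (i th)]. *)
Definition wave z th : R := z.1 * cos th - z.2 * sin th.

(** Complex multiplication of [z] by [cosL L s + i c.1 sinL L s], which for [c.1 = 1] or [-1] is the
    integral of exp(- s x + i c.1 x) over [0, L]. *)
Definition osc_step L c s z : R * R :=
  (z.1 * cosL L s - c.1 * z.2 * sinL L s, z.2 * cosL L s + c.1 * z.1 * sinL L s).

(* Product of the complex numbers [cosL + i c.1 sinL], taken at [c.2 t]. *)
Fixpoint osc L cs t : R * R :=
  if cs is c :: cs' then osc_step L c (c.2 * t) (osc L cs' t) else (1, 0).

Let derivable_continuous (f : R -> R) (x : R) :
  derivable f x 1 -> {for x, continuous f}.
Proof. by move=> df; apply/differentiable_continuous/derivable1_diffP. Qed.

Let sqr1D_gt0 s : 0 < 1 + s ^+ 2.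
Proof. by rewrite ltr_pwDl// sqr_ge0. Qed.

Lemma continuous_expR_wave s z th e :
  continuous (fun x => expR (- (s * x)) * wave z (th + e * x)).
Proof.
by move=> x; apply: derivable_continuous; apply: ex_derive.
Qed.

Lemma Rintegral_wave L s c z th : 0 < L -> c.1 = 1 \/ c.1 = -1 ->
  \int[mu]_(x in `[0, L]) (expR (- (s * x)) * wave z (th + c.1 * x)) =
  wave (osc_step L c s z) th.
Proof.
move=> L0 e1; set e := c.1.
(* The real part of z exp(i (th + e x) - s x) / (i e - s); as e^2 = 1, the denominator has squared
   modulus 1 + s^2. *)
pose F x := expR (- (s * x)) * (1 + s ^+ 2)^-1 *
  (z.1 * (e * sin (th + e * x) - s * cos (th + e * x)) +
   z.2 * (e * cos (th + e * x) + s * sin (th + e * x))).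
have dF (x : R) : x \in `[0, L] ->
    is_derive x 1 F (expR (- (s * x)) * wave z (th + e * x)).
  move=> _; apply: is_derive_eq.
  rewrite /wave /GRing.scale/=.
  have ss : 1 + s ^+ 2 != 0 by rewrite gt_eqF.
  by case: e1; rewrite -/e => ->; field.
rewrite /Rintegral (@integral_itvcc_is_derive _ _ F)//=; last first.
  by move=> x _; exact: continuous_expR_wave.
rewrite /F /wave /osc_step /cosL /sinL /= -/e !mulr0 oppr0 expR0 addr0 cosD sinD.
have -> : cos (e * L) = cos L.
  by case: e1; rewrite -/e => ->; rewrite ?mul1r ?mulN1r ?cosN.
have -> : sin (e * L) = e * sin L.
  by case: e1; rewrite -/e => ->; rewrite ?mul1r ?mulN1r ?sinN ?mulN1r.
have ss : 1 + s ^+ 2 != 0 by rewrite gt_eqF.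
by case: e1; rewrite -/e => ->; field.
Qed.

Lemma continuous_cosL L : continuous (cosL L).
Proof.
move=> s; apply: cvgM; last first.
  by apply: cvgV; [rewrite gt_eqF|apply: cvgD; [exact: cvg_cst|exact: exprn_continuous]].
apply: (@derivable_continuous
  (fun s => s + expR (- (s * L)) * (sin L - s * cos L))).
exact: ex_derive.
Qed.

Lemma continuous_sinL L : continuous (sinL L).
Proof.
move=> s; apply: cvgM; last first.
  by apply: cvgV; [rewrite gt_eqF|apply: cvgD; [exact: cvg_cst|exact: exprn_continuous]].
apply: (@derivable_continuous
  (fun s => 1 - expR (- (s * L)) * (cos L + s * sin L))).
exact: ex_derive.
Qed.

Lemma continuous_osc L cs :
  continuous (fun t => (osc L cs t).1) /\ continuous (fun t => (osc L cs t).2).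
Proof.
elim: cs => [|c cs [IH1 IH2]] /=; first by split => t; exact: cvg_cst.
have cC : continuous (fun t => cosL L (c.2 * t)).
  move=> t; apply: (cvg_comp (fun t => c.2 * t) (cosL L)); last exact: continuous_cosL.
  by apply: cvgM; [exact: cvg_cst|exact: cvg_id].
have cS : continuous (fun t => sinL L (c.2 * t)).
  move=> t; apply: (cvg_comp (fun t => c.2 * t) (sinL L)); last exact: continuous_sinL.
  by apply: cvgM; [exact: cvg_cst|exact: cvg_id].
split=> t.
  apply: cvgB; first by apply: cvgM; [exact: IH1|exact: cC].
  by apply: cvgM; [apply: cvgM; [exact: cvg_cst|exact: IH2]|exact: cS].
apply: cvgD; first by apply: cvgM; [exact: IH2|exact: cC].
by apply: cvgM; [apply: cvgM; [exact: cvg_cst|exact: IH1]|exact: cS].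
Qed.

Let expRN_le1 s L : 0 <= s -> 0 <= L -> expR (- (s * L)) <= 1.
Proof. by move=> s0 L0; rewrite -expR0 ler_expR oppr_le0 mulr_ge0. Qed.

Let ler_lin s (x y : R) : 0 <= s -> `|x| <= 1 -> `|y| <= 1 ->
  `|x + s * y| <= 1 + s.
Proof.
move=> s0 x1 y1; rewrite (le_trans (ler_normD _ _))// lerD// normrM ger0_norm//.
by rewrite ler_piMr.
Qed.

(** The numerator is at most 1 + 2 s, and (1 + 2 s) (1 + s) <= 4 (1 + s^2). *)
Lemma cosL_le L s : 0 <= L -> 0 <= s -> `|cosL L s| <= 4 / (1 + s).
Proof.
move=> L0 s0; rewrite normrM (gtr0_norm (x := _^-1)) ?invr_gt0//.
have h : `|s + expR (- (s * L)) * (sin L - s * cos L)| <= s + (1 + s).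
  rewrite (le_trans (ler_normD _ _))// (ger0_norm s0) lerD2l normrM.
  rewrite ger0_norm ?expR_ge0// -[leRHS]mul1r ler_pM ?expR_ge0 ?expRN_le1//.
  by rewrite -mulrN ler_lin// ?normrN ?sin_max ?cos_max.
rewrite ler_pdivrMr// (le_trans h)// mulrAC ler_pdivlMr ?ltr_pwDl//.
nra.
Qed.

Lemma sinL_le L s : 0 <= L -> 0 <= s -> `|sinL L s| <= 4 / (1 + s).
Proof.
move=> L0 s0; rewrite normrM (gtr0_norm (x := _^-1)) ?invr_gt0//.
have h : `|1 - expR (- (s * L)) * (cos L + s * sin L)| <= 1 + (1 + s).
  rewrite (le_trans (ler_normB _ _))// normr1 lerD2l normrM.
  rewrite ger0_norm ?expR_ge0// -[leRHS]mul1r ler_pM ?expR_ge0 ?expRN_le1//.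
  by rewrite ler_lin// ?sin_max ?cos_max.
rewrite ler_pdivrMr// (le_trans h)// mulrAC ler_pdivlMr ?ltr_pwDl//.
nra.
Qed.

End oscillation.

(** * Box integrals as integrals over one auxiliary variable t *)

Section box_oscillation.
Context {R : realType}.
Notation mu := (@lebesgue_measure R).
Implicit Types (L s t e w th : R) (c z : R * R) (cs : seq (R * R)).

(** A pair [c] holds the sign [c.1] of a variable in the phase and its coefficient [c.2] in the
    denominator. The default 0 of [head] matches that of [nth], so the later identifications hold
    for lists of any length. *)
Fixpoint phase cs (xs : seq R) : R :=
  if cs is c :: cs' then c.1 * head 0 xs + phase cs' (behead xs) else 0.

Fixpoint weight cs (xs : seq R) : R :=
  if cs is c :: cs' then c.2 * head 0 xs + weight cs' (behead xs) else 0.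

Definition osc_ok cs : bool :=
  all (fun c => ((c.1 == 1) || (c.1 == -1)) && (0 < c.2)) cs.

(** Reduces the decay of factors with different weights to powers of the single quantity 1 + t. *)
Let inv1D_le w t : 0 < w -> 0 <= t -> (1 + w * t)^-1 <= (1 + w^-1) / (1 + t).
Proof.
move=> w0 t0.
have wt : 0 <= w * t by rewrite mulr_ge0// ltW.
rewrite ler_pdivlMr ?ltr_pwDl// ler_pdivrMl ?ltr_pwDl//.
have -> : (1 + w * t) * (1 + w^-1) = 1 + t + w * t + w^-1.
  by field; rewrite gt_eqF.
by rewrite -addrA lerDl addr_ge0// invr_ge0 ltW.
Qed.

Lemma osc_le L cs : 0 <= L -> osc_ok cs -> exists2 M : R, 0 <= M &
  forall t, 0 <= t -> `|(osc L cs t).1| <= M / (1 + t) ^+ size cs /\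
                      `|(osc L cs t).2| <= M / (1 + t) ^+ size cs.
Proof.
move=> L0; elim: cs => [_|c cs IH /= /andP[/andP[e1 w0] /IH [M M0 IHM]]].
  by exists 1 => // t t0 /=; rewrite expr0 divr1 normr0 normr1.
(* Each component of [osc_step] is a sum of two products, and each product brings a 4 from [cosL_le]
   or [sinL_le]; the last factor comes from [inv1D_le]. *)
exists (8 * M * (1 + c.2^-1)) => [|t t0].
  by rewrite !mulr_ge0// addr_ge0// invr_ge0 ltW.
have [M1 M2] := IHM t t0.
have t1 : 0 < 1 + t by rewrite ltr_pwDl.
have wt : 0 <= c.2 * t by rewrite mulr_ge0// ltW.
have C1 := cosL_le L0 wt; have S1 := sinL_le L0 wt.
have e1n : `|c.1| = 1 by case/orP: e1 => /eqP ->; rewrite ?normrN normr1.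
have key (a b x y : R) : `|a| <= M / (1 + t) ^+ size cs ->
    `|b| <= M / (1 + t) ^+ size cs -> `|x| <= 4 / (1 + c.2 * t) ->
    `|y| <= 4 / (1 + c.2 * t) ->
    `|a| * `|x| + `|b| * `|y| <=
    8 * M * (1 + c.2^-1) / (1 + t) ^+ (size cs).+1.
  move=> ha hb hx hy.
  apply: (@le_trans _ _ (2 * (M / (1 + t) ^+ size cs * (4 / (1 + c.2 * t))))).
    by rewrite mulr_natl mulr2n lerD// ler_pM.
  rewrite [leRHS](_ : _ = 2 * (M / (1 + t) ^+ size cs *
      (4 * ((1 + c.2^-1) / (1 + t))))).
    rewrite ler_pM2l// ler_wpM2l ?divr_ge0 ?exprn_ge0 ?(ltW t1)//.
    by rewrite ler_pM2l// inv1D_le.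
  rewrite exprS; field.
  by rewrite expf_neq0 ?gt_eqF.
split => /=.
  rewrite (le_trans (ler_normB _ _))// normrM [X in _ + X]normrM [X in _ + X * _]normrM.
  by rewrite e1n mul1r; exact: key.
rewrite (le_trans (ler_normD _ _))// normrM [X in _ + X]normrM [X in _ + X * _]normrM.
by rewrite e1n mul1r; exact: key.
Qed.

Lemma wave_osc_le L cs : 0 <= L -> osc_ok cs -> exists2 M : R, 0 <= M &
  forall t th, 0 <= t -> `|wave (osc L cs t) th| <= M / (1 + t) ^+ size cs.
Proof.
move=> L0 /(osc_le L0) [M M0 h]; exists (2 * M); first by rewrite mulr_ge0.
move=> t th t0; have [h1 h2] := h t t0.
rewrite (le_trans (ler_normB _ _))// -mulrA mulr_natl mulr2n.
by rewrite !normrM lerD// -[leRHS]mulr1 ler_pM// ?sin_max ?cos_max.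
Qed.

Lemma measurable_expR_wave_osc L cs s w e th :
  measurable_fun setT (fun z : R * R =>
    expR (- ((s + w * z.1) * z.2)) * wave (osc L cs z.2) (th + e * z.1)).
Proof.
have [c1 c2] := continuous_osc L cs.
have m1 : measurable_fun setT (fun z : R * R => z.1) by exact: measurable_fst.
have m2 : measurable_fun setT (fun z : R * R => z.2) by exact: measurable_snd.
have m3 : measurable_fun setT (fun z : R * R => th + e * z.1).
  by apply: measurable_funD => //; exact: measurable_funM.
apply: measurable_funM.
  apply: measurableT_comp => //; apply: measurable_funN.
  apply: measurable_funM => //; apply: measurable_funD => //.
  exact: measurable_funM.
apply: measurable_funB; apply: measurable_funM.
- apply: (measurableT_comp (continuous_measurable_fun c1)) => //.
- apply: (measurableT_comp (continuous_measurable_fun (@continuous_cos R))) => //.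
- apply: (measurableT_comp (continuous_measurable_fun c2)) => //.
- apply: (measurableT_comp (continuous_measurable_fun (@continuous_sin R))) => //.
Qed.

Let measurable_normr_slice L cs s w e th t (D : set R) :
  measurable_fun D (fun x => (`|expR (- ((s + w * x) * t)) *
    wave (osc L cs t) (th + e * x)|)%:E).
Proof.
apply: measurable_funTS; apply/measurable_EFinP; apply: measurableT_comp => //.
exact: (measurableT_comp (measurable_expR_wave_osc L cs s w e th)
  (measurable_pair2 t)).
Qed.

(** At fixed [t], integrating out one more variable multiplies the accumulated complex number by one
    more factor. *)
Lemma Rintegral_expR_wave_osc L c cs s t th : 0 < L -> c.1 = 1 \/ c.1 = -1 ->
  \int[mu]_(x in `[0, L]) (expR (- ((s + c.2 * x) * t)) *
     wave (osc L cs t) (th + c.1 * x)) =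
  expR (- (s * t)) * wave (osc L (c :: cs) t) th.
Proof.
move=> L0 e1 /=; rewrite -Rintegral_wave// -RintegralZl//; last first.
  apply: continuous_compact_integrable; first exact: segment_compact.
  by apply: continuous_subspaceT; exact: continuous_expR_wave.
apply: eq_Rintegral => x _; rewrite mulrA -expRD; congr (expR _ * _).
by ring.
Qed.

Lemma integrable_expRN s : 0 < s ->
  mu.-integrable `[0, +oo[ (EFin \o (fun t => expR (- (s * t)))).
Proof.
move=> s0; apply/integrableP; split.
  by apply/measurable_EFinP; exact: measurable_expRN.
under eq_integral do rewrite /= ger0_norm ?expR_ge0//.
by rewrite integral_expRN// ltry.
Qed.

(** Induction for all [th] and [s]: the outermost variable [x] is absorbed into the phase
    [th + c.1 * x] and the damping [s + c.2 * x], which stays positive. Fubini then brings the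
    integral over [x] inside. *)
Lemma box_int_osc_gt0 L cs s th : 0 < L -> osc_ok cs -> 0 < s ->
  box_int (size cs) L (fun xs => cos (th + phase cs xs) / (s + weight cs xs)) =
  \int[mu]_(t in `[0, +oo[) (expR (- (s * t)) * wave (osc L cs t) th).
Proof.
move=> L0; elim: cs s th => [|c cs IH] s th ok s0.
  rewrite /= /wave !addr0 mul1r mul0r subr0 RintegralZr//; last exact: integrable_expRN.
  by rewrite /Rintegral integral_expRN//= mulrC.
rewrite [box_int _ _ _]/=; move: ok => /= /andP[/andP[e1 w0] ok].
have e1' : c.1 = 1 \/ c.1 = -1 by case/orP: e1 => /eqP; [left|right].
transitivity (\int[mu]_(x in `[0, L]) \int[mu]_(t in `[0, +oo[)
    (expR (- ((s + c.2 * x) * t)) * wave (osc L cs t) (th + c.1 * x))).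
  apply: eq_Rintegral => x; rewrite inE/= in_itv/= => /andP[x0 _].
  rewrite -IH//; last by rewrite ltr_wpDr// mulr_ge0// ltW.
  by congr box_int; apply/funext => xs; rewrite !addrA.
have [M M0 HM] := wave_osc_le (ltW L0) ok.
pose f (z : R * R) :=
  expR (- ((s + c.2 * z.1) * z.2)) * wave (osc L cs z.2) (th + c.1 * z.1).
transitivity (\int[mu]_(t in `[0, +oo[) \int[mu]_(x in `[0, L]) f (x, t)); last first.
  by apply: eq_Rintegral => t _; exact: Rintegral_expR_wave_osc.
(* The damping exp(- s t) alone gives integrability in [t]; the wave is merely bounded by [M], since
   [cs] may be empty here. *)
apply: (@Rintegral_Fubini _ _ _ _ R mu mu _ _ f
  (fun t => L * M * expR (- (s * t)))) => //.
- exact: measurable_expR_wave_osc.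
- by apply: integrable_EFinZl => //; exact: integrable_expRN.
- move=> t /=; rewrite in_itv/= andbT => t0.
  apply: (@le_trans _ _ (\int[mu]_(x in `[0%R, L]) (M * expR (- (s * t)))%:E)%E); last first.
    rewrite integral_cst//= lebesgue_measure_itv/= lte_fin L0 -EFinD -EFinM.
    by rewrite lee_fin subr0 mulrC mulrA.
  apply: ge0_le_integral => //.
  + exact: measurable_normr_slice.
  + move=> x /=; rewrite in_itv/= lee_fin => /andP[x0 _].
    rewrite normrM ger0_norm ?expR_ge0// mulrC ler_pM//.
      rewrite (le_trans (HM _ _ t0))// ler_piMr// invf_le1 ?exprn_gt0 ?ltr_pwDl//.
      by rewrite exprn_ege1// lerDl.
    by rewrite ler_expR lerN2 ler_wpM2r// lerDl mulr_ge0// ltW.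
Qed.

(* Only [`]0, L]] can be used for the outermost variable: at [x = 0] the inner
   integral may diverge. *)
Lemma box_int_osc L c cs th : 0 < L -> (0 < size cs)%N -> osc_ok (c :: cs) ->
  box_int (size cs).+1 L
    (fun xs => cos (th + phase (c :: cs) xs) / weight (c :: cs) xs) =
  \int[mu]_(t in `[0, +oo[) wave (osc L (c :: cs) t) th.
Proof.
move=> L0 cs0 /= /andP[/andP[e1 w0] ok].
have e1' : c.1 = 1 \/ c.1 = -1 by case/orP: e1 => /eqP; [left|right].
pose f (z : R * R) :=
  expR (- ((0 + c.2 * z.1) * z.2)) * wave (osc L cs z.2) (th + c.1 * z.1).
have [M M0 HM] := wave_osc_le (ltW L0) ok.
(* Without damping, one 1 / (1 + t) comes from the nonempty [cs] and another from integrating exp(-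
   c.2 t x) over [x]. Their product is at most [prod_invD 1 1 t], that is 1 / (1 + t^2). *)
pose g t := M * (1 + c.2^-1) * (L + 1) * prod_invD 1 1 t.
have ig : mu.-integrable `[0, +oo[ (EFin \o g).
  by apply: integrable_EFinZl => //; exact: integrable_prod_invD.
have fg t : `[0, +oo[%classic t ->
    (\int[mu]_(x in `]0%R, L]) (`|f (x, t)|)%:E <= (g t)%:E)%E.
  rewrite /= in_itv/= andbT => t0.
  have wt : 0 <= c.2 * t by rewrite mulr_ge0// ltW.
  pose k : R := M / (1 + t) * (1 + c.2 * t)^-1.
  have k0 : 0 <= k by rewrite mulr_ge0 ?divr_ge0 ?invr_ge0 ?addr_ge0.
  (* With w = c.2 t, exp(- w x) <= 1 gives exp(- w x) <= (1 + w exp(- w x)) / (1 + w). The right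
     side integrates to at most (L + 1) / (1 + w), with no division by w. *)
  apply: (@le_trans _ _ (\int[mu]_(x in `]0%R, L])
      (k * (1 + c.2 * t * expR (- (c.2 * t * x))))%:E)%E).
    apply: ge0_le_integral => //.
    - exact: measurable_normr_slice.
    - apply/measurable_EFinP; apply: measurable_funM => //.
      by apply: measurable_funD => //; exact: measurable_funZl_expRN.
    - move=> x /=; rewrite in_itv/= lee_fin => /andP[/ltW x0 _].
      rewrite /f/= add0r normrM ger0_norm ?expR_ge0// mulrC.
      have h := HM t (th + c.1 * x) t0.
      rewrite /k -[leRHS]mulrA ler_pM//.
        rewrite (le_trans h)// ler_wpM2l// lef_pV2 ?posrE ?exprn_gt0 ?ltr_pwDl//.
        by rewrite ler_eXnr// lerDl.
      rewrite ler_pdivlMl ?ltr_pwDl// mulrDl mul1r mulrAC lerD2r.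
      by rewrite -expR0 ler_expR oppr_le0 !mulr_ge0// ltW.
  rewrite integral_itv_obnd_cbnd; last first.
    apply/measurable_EFinP; apply: measurable_funM => //.
    by apply: measurable_funD => //; exact: measurable_funZl_expRN.
  pose F x := k * (x - expR (- (c.2 * t * x))).
  have dF (x : R) : x \in `[0, L] ->
      is_derive x 1 F (k * (1 + c.2 * t * expR (- (c.2 * t * x)))).
    move=> _; apply: is_derive_eq; rewrite /GRing.scale/=; ring.
  rewrite (@integral_itvcc_is_derive _ _ F 0 L)//; last first.
    move=> x _; apply/differentiable_continuous/derivable1_diffP.
    by apply: ex_derive.
  have L1 : F L - F 0 <= k * (L + 1).
    rewrite /F mulr0 oppr0 expR0 -mulrBr ler_wpM2l//.
    by have := expR_ge0 (- (c.2 * t * L)); lra.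
  rewrite lee_fin (le_trans L1)// /g [leRHS]mulrAC ler_wpM2r ?addr_ge0 ?(ltW L0)//.
  rewrite /k -!mulrA ler_wpM2l// prod_invDSl /prod_invD big_ord0 mulr1.
  apply: (@le_trans _ _ ((1 + t)^-1 * ((1 + c.2^-1) / (1 + t)))).
    by rewrite ler_wpM2l ?invr_ge0 ?addr_ge0// inv1D_le.
  rewrite mulrCA ler_wpM2l ?addr_ge0 ?invr_ge0 ?(ltW w0)// -invfM.
  have t21 : 0 < t ^+ 2 + 1 ^+ 2 by rewrite ltr_wpDl ?sqr_ge0// expr1n.
  have tt : 0 < (1 + t) * (1 + t) by rewrite mulr_gt0// ltr_pwDl.
  by rewrite lef_pV2 ?posrE//; nra.
have mf : measurable_fun setT f := measurable_expR_wave_osc L cs 0 c.2 c.1 th.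
have mH : measurable_fun `]0, L] (fun x => \int[mu]_(t in `[0, +oo[) f (x, t)).
  exact: (@measurable_Rintegral2 _ _ _ _ R mu mu _ _ f g).
pose H x := box_int (size cs) L (fun xs =>
  cos (th + (c.1 * x + phase cs xs)) / (c.2 * x + weight cs xs)).
have HE x : x \in `]0, L]%classic -> \int[mu]_(t in `[0, +oo[) f (x, t) = H x.
  rewrite inE/= in_itv/= => /andP[x0 _].
  rewrite /f /= -(box_int_osc_gt0 _ L0 ok); last by rewrite add0r mulr_gt0.
  by congr box_int; apply/funext => xs; rewrite addrA add0r.
(* Removing the endpoint 0 requires [H] to be measurable; this is inherited from the integral over
   [t], with which it agrees on []0, L]]. *)
transitivity (\int[mu]_(x in `]0, L]) H x).
  rewrite /Rintegral integral_itv_obnd_cbnd//; apply/measurable_EFinP.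
  exact: eq_measurable_fun HE mH.
transitivity (\int[mu]_(x in `]0, L]) \int[mu]_(t in `[0, +oo[) f (x, t)).
  by apply: eq_Rintegral => x /HE.
transitivity (\int[mu]_(t in `[0, +oo[) \int[mu]_(x in `]0, L]) f (x, t)).
  exact: (@Rintegral_Fubini _ _ _ _ R mu mu _ _ f g).
apply: eq_Rintegral => t _; have := @Rintegral_expR_wave_osc L c cs 0 t th L0 e1'.
rewrite mul0r oppr0 expR0 mul1r => <-.
rewrite /Rintegral integral_itv_obnd_cbnd//; apply/measurable_EFinP.
apply: measurable_funTS.
exact: (measurableT_comp mf (measurable_pair2 t)).
Qed.

End box_oscillation.

(** * The alternating phase: conjugate pairs, squared moduli, and the limit of large boxes *)

Section alternating.
Context {R : realType}.
Notation mu := (@lebesgue_measure R).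
Implicit Types (a L s t th : R) (k : nat) (xs : seq R).

Fixpoint alt_coefs a k : seq (R * R) :=
  if k is k'.+1 then [:: (1, a^-1), (-1, a^-1) & alt_coefs (a + 1) k'] else [::].

Lemma size_alt_coefs a k : size (alt_coefs a k) = (2 * k)%N.
Proof. by elim: k a => //= k IH a; rewrite IH mulnS. Qed.

Lemma alt_coefs_ok a k : 0 < a -> osc_ok (alt_coefs a k).
Proof.
elim: k a => //= k IH a a0.
by rewrite !eqxx orbT invr_gt0 a0/= IH// addr_gt0.
Qed.

Lemma phase_alt_coefs a k xs : phase (alt_coefs a k) xs = alt_sum k xs.
Proof.
elim: k a xs => [|k IH] a xs; first by rewrite /alt_sum big_ord0.
rewrite /= IH /alt_sum (mulnS 2 k) /Defs.coord !big_ord_recl/= expr0 expr1 !addrA.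
congr (_ + _); first by case: xs => [|x [|y xs]].
apply: eq_bigr => i _; congr (_ * _).
  by rewrite /bump/= !add1n !exprS mulrA mulrNN !mul1r.
by case: xs => [|x [|y xs]] /=; rewrite ?add0n /Defs.coord ?nth_nil.
Qed.

Lemma weight_alt_coefs a k xs : weight (alt_coefs a k) xs = wdenom a k xs.
Proof.
elim: k a xs => [|k IH] a xs; first by rewrite /wdenom !big_ord0 addr0.
rewrite [LHS]/= IH /wdenom !big_ord_recl.
have e (i : nat) : a + 1 + i%:R = a + i.+1%:R by rewrite -addrA nat1r.
under eq_bigr => i _.
  rewrite e (_ : Defs.coord _ _ = Defs.coord xs (2 * lift ord0 i + 1)).
    over.
  by rewrite /Defs.coord !nth_behead mulnS.
under [X in _ + (_ + (_ + X)) = _]eq_bigr => i _.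
  rewrite e (_ : Defs.coord _ _ = Defs.coord xs (2 * lift ord0 i)).
    over.
  by rewrite /Defs.coord !nth_behead mulnS.
rewrite /Defs.coord/= !addr0 -!nth0 nth_behead; ring.
Qed.

(** The squared modulus of the integral of exp((i - s) x) over [0, L]. *)
Definition osc_sq L s : R := cosL L s ^+ 2 + sinL L s ^+ 2.

(** The variables come in pairs of equal weight and opposite sign, so their factors are conjugate
    and the product is real. *)
Lemma osc_alt_coefs L a k t : osc L (alt_coefs a k) t =
  (\prod_(n < k) osc_sq L (t / (a + n%:R)), 0).
Proof.
elim: k a => [|k IH] a; first by rewrite big_ord0.
rewrite /= IH /osc_step/= big_ord_recl/= addr0 [t / a]mulrC.
have -> : \prod_(i < k) osc_sq L (t / (a + (bump 0 i)%:R)) =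
    \prod_(n < k) osc_sq L (t / (a + 1 + n%:R)).
  by apply: eq_bigr => i _; rewrite /bump/= add1n -addrA nat1r.
by rewrite /osc_sq; congr (_, _); ring.
Qed.

(** The numerator is the squared modulus of 1 - exp(- s L + i L). *)
Lemma osc_sqE L s : osc_sq L s =
  (1 - 2 * expR (- (s * L)) * cos L + expR (- (s * L)) ^+ 2) / (1 + s ^+ 2).
Proof.
have ss : 1 + s ^+ 2 != 0 by rewrite gt_eqF// ltr_pwDl// sqr_ge0.
rewrite /osc_sq /cosL /sinL; set e := expR _.
have -> : e ^+ 2 = e ^+ 2 * (cos L ^+ 2 + sin L ^+ 2) by rewrite cos2Dsin2 mulr1.
by field.
Qed.

Lemma osc_sq_ge0 L s : 0 <= osc_sq L s.
Proof. by rewrite addr_ge0 ?sqr_ge0. Qed.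

(** Unlike the constants [M] above, this bound is uniform in [L], as dominated convergence
    requires. *)
Lemma osc_sq_le L s : 0 <= L -> 0 <= s -> osc_sq L s <= 4 * (1 + s ^+ 2)^-1.
Proof.
move=> L0 s0; rewrite osc_sqE ler_wpM2r ?invr_ge0 ?addr_ge0 ?sqr_ge0//.
have e0 := expR_ge0 (- (s * L)).
have e1 : expR (- (s * L)) <= 1 by rewrite -expR0 ler_expR oppr_le0 mulr_ge0.
have := cos_geN1 L; have := cos_le1 L; nra.
Qed.

(** The damping removes the oscillating term. At [s = 0] the value is 2 - 2 cos L, which keeps
    oscillating. *)
Lemma cvg_osc_sq s : 0 < s -> osc_sq n%:R s @[n --> \oo] --> (1 + s ^+ 2)^-1.
Proof.
move=> s0; rewrite (eq_cvg _ _ (fun n : nat => osc_sqE n%:R s)).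
rewrite -[(1 + s ^+ 2)^-1 in X in _ --> X]mul1r; apply: cvgM; last exact: cvg_cst.
have e0 : expR (- (s * n%:R)) @[n --> \oo] --> (0 : R).
  apply: (cvg_comp (fun n : nat => s * n%:R) (fun x => expR (- x))); last exact: cvgr_expR.
  apply/cvgryPge => A; near=> n.
  rewrite mulrC -ler_pdivrMr//; near: n; exact: nbhs_infty_ger.
have ec : 2 * expR (- (s * n%:R)) * cos n%:R @[n --> \oo] --> (0 : R).
  apply: (@squeeze_cvgr _ _ _ _ (fun n => - 2 * expR (- (s * n%:R)))
      (fun n => 2 * expR (- (s * n%:R)))).
  - apply: nearW => n; have := expR_ge0 (- (s * n%:R)).
    have := cos_geN1 (n%:R : R); have := cos_le1 (n%:R : R).
    by move=> c1 c2 ex0; apply/andP; split; nra.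
  - by rewrite -[X in _ --> X](mulr0 (- 2)); apply: cvgM => //; exact: cvg_cst.
  - by rewrite -[X in _ --> X](mulr0 2); apply: cvgM => //; exact: cvg_cst.
rewrite -[X in _ --> X]addr0; apply: cvgD.
  by rewrite -[X in _ --> X]subr0; apply: cvgB => //; exact: cvg_cst.
by rewrite -[X in _ --> X](mulr0 0); apply: cvgM.
Unshelve. all: by end_near. Qed.

(** The free phase [th] covers both integrands: [th = 0] is the cosine, [th = - pi / 2] the sine.
    Since the product is real, [th] survives only in the factor [cos th]. *)
Lemma box_int_cos_alt L a k th : 0 < L -> 0 < a ->
  box_int (2 * k.+1) L (fun xs => cos (th + alt_sum k.+1 xs) / wdenom a k.+1 xs) =
  \int[mu]_(t in `[0, +oo[) (\prod_(n < k.+1) osc_sq L (t / (a + n%:R)) * cos th).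
Proof.
move=> L0 a0.
have -> : (fun xs => cos (th + alt_sum k.+1 xs) / wdenom a k.+1 xs) =
    (fun xs => cos (th + phase (alt_coefs a k.+1) xs) / weight (alt_coefs a k.+1) xs).
  by apply/funext => xs; rewrite phase_alt_coefs weight_alt_coefs.
rewrite -(size_alt_coefs a).
apply: etrans (@box_int_osc R L (1, a^-1) ((-1, a^-1) :: alt_coefs (a + 1) k) th
  L0 isT (alt_coefs_ok k.+1 a0)) _.
apply: eq_Rintegral => t _.
by rewrite -[X in osc L X]/(alt_coefs a k.+1) osc_alt_coefs /wave/= mul0r subr0.
Qed.

Lemma cvg_Rintegral_osc_sq a k : 0 < a ->
  \int[mu]_(t in `[0, +oo[) (\prod_(n < k.+1) osc_sq m%:R (t / (a + n%:R)))
    @[m --> \oo] -->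
  \int[mu]_(t in `[0, +oo[) prod_inv1D a k.+1 t.
Proof.
move=> a0.
pose F (m : nat) t := \prod_(n < k.+1) osc_sq m%:R (t / (a + n%:R)).
have an (n : nat) : 0 < a + n%:R by rewrite ltr_wpDr.
have mF m (D : set R) : measurable_fun D (F m).
  have [c1 _] := continuous_osc m%:R (alt_coefs a k.+1).
  apply: measurable_funTS; apply: continuous_measurable_fun.
  rewrite (_ : F m = fun t => (osc m%:R (alt_coefs a k.+1) t).1)//.
  by apply/funext => t; rewrite osc_alt_coefs.
have prodE : prod_inv1D a k.+1 =
    fun t => \prod_(n < k.+1) (a + n%:R) ^+ 2 * prod_invD a k.+1 t.
  by apply/funext => t; exact: prod_inv1DE.
have iP : mu.-integrable `[0, +oo[ (EFin \o prod_inv1D a k.+1).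
  by rewrite prodE; apply: integrable_EFinZl => //; exact: integrable_prod_invD.
have mP : measurable_fun (`]0, +oo[ : set R) (prod_inv1D a k.+1).
  by rewrite prodE; apply: measurable_funM => //; exact: measurable_prod_invD.
have F0 m t : 0 <= F m t by apply: prodr_ge0 => n _; exact: osc_sq_ge0.
have FP m t : 0 <= t -> F m t <= 4 ^+ k.+1 * prod_inv1D a k.+1 t.
  move=> t0; rewrite -[X in 4 ^+ X]card_ord -prodr_const -big_split/=.
  apply: ler_prod => n _; rewrite osc_sq_ge0 osc_sq_le//.
  by rewrite divr_ge0// ltW.
have Fcvg t : 0 < t -> F m t @[m --> \oo] --> prod_inv1D a k.+1 t.
  move=> t0; rewrite /F /prod_inv1D; elim: k.+1 => [|j IH].
    rewrite big_ord0 (eq_cvg _ _ (fun m => big_ord0 _ _ _ _)); exact: cvg_cst.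
  rewrite big_ord_recr (eq_cvg _ _ (fun m => big_ord_recr _ _))/=.
  by apply: cvgM => //; apply: cvg_osc_sq; rewrite divr_gt0.
(* The open ray is used because pointwise convergence is available only for [t > 0]. *)
have := @dominated_convergence _ _ R mu `]0%R, +oo[ _
  (fun m => EFin \o F m) (EFin \o prod_inv1D a k.+1)
  (EFin \o (fun t => 4 ^+ k.+1 * prod_inv1D a k.+1 t)).
move=> /(_ (measurable_itv _)) [].
- by move=> m; apply/measurable_EFinP; exact: mF.
- exact/measurable_EFinP.
- apply: aeW => t; rewrite /= in_itv/= andbT => t0.
  by apply: cvg_EFin; [exact: nearW|exact: Fcvg].
- apply: integrable_EFinZl => //; apply: integrableS iP => // t /=.
  by rewrite !in_itv/= !andbT => /ltW.
- apply: aeW => t m; rewrite /= in_itv/= andbT => /ltW t0.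
  by rewrite lee_fin ger0_norm// FP.
move=> iP' _ H.
have oc (f : R -> R) : measurable_fun (`]0, +oo[ : set R) f ->
    \int[mu]_(t in `[0, +oo[) f t = \int[mu]_(t in `]0, +oo[) f t.
  by move=> mf; rewrite /Rintegral integral_itv_obnd_cbnd//; exact/measurable_EFinP.
rewrite oc// (eq_cvg _ _ (fun m => oc _ (mF m _))).
by apply: fine_cvg; rewrite fineK//; exact: integrable_fin_num iP'.
Qed.

End alternating.

(** * Both limits: the cosine integrals and the vanishing of the sine integrals *)

Theorem theorem4p2 (R : realType) (a : R) (ha : 0 < a) :
  (forall Ic : nat -> R,
     (forall k : nat,
        box_int (2 * k) L (cos_integrand a k) @[L --> +oo] --> Ic k) ->
     Ic @ \oo --> 2^-1 * Num.sqrt pi * (Gamma (a + 2^-1) / Gamma a))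
  /\
  (forall (k : nat) (l : R),
     box_int (2 * k) L (sin_integrand a k) @[L --> +oo] --> l ->
     l = 0).
Proof.
split=> [Ic HI|[|k] l Hl].
- suff HIk k : Ic k.+1 = \int[@lebesgue_measure R]_(t in `[0, +oo[) prod_inv1D a k.+1 t.
    rewrite -cvg_shiftS (eq_cvg _ _ HIk).
    exact: cvg_Rintegral_prod_inv1D.
  (* The assumed limit in real [L] is evaluated along integer [L], where dominated convergence for
     sequences identifies it. *)
  have := (cvg_pinftyP _ _).1 (HI k.+1) _ (@cvgr_idn R) => HIn.
  suff H2 : box_int (2 * k.+1) n%:R (cos_integrand a k.+1) @[n --> \oo] -->
      \int[@lebesgue_measure R]_(t in `[0, +oo[) prod_inv1D a k.+1 t.
    exact: (cvg_unique _ HIn H2).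
  have E m : box_int (2 * k.+1) m.+1%:R (cos_integrand a k.+1) =
      \int[@lebesgue_measure R]_(t in `[0, +oo[)
        (\prod_(n < k.+1) osc_sq m.+1%:R (t / (a + n%:R))).
    have -> : cos_integrand a k.+1 =
        fun xs => cos (0 + alt_sum k.+1 xs) / wdenom a k.+1 xs.
      by apply/funext => xs; rewrite add0r.
    rewrite box_int_cos_alt//.
    by apply: eq_Rintegral => t _; rewrite cos0 mulr1.
  (* The side length is shifted to [m.+1] so that the box is nondegenerate. *)
  rewrite -cvg_shiftS (eq_cvg _ _ E).
  by have := cvg_Rintegral_osc_sq (k := k) ha; rewrite -cvg_shiftS.
(* For [k = 0] the phase is an empty sum, so the integrand is sin 0 over an empty denominator, which
   is 0. *)
- apply: (cvg_unique _ Hl) => //; apply: cvg_near_cst; near=> L.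
  rewrite /= /sin_integrand /alt_sum muln0 big_ord0.
  by rewrite sin0 mul0r.
- apply: (cvg_unique _ Hl) => //; apply: cvg_near_cst; near=> L.
  (* Writing sin x as cos (x - pi / 2), the integral over each box carries the factor cos (- pi / 2)
     = 0, so it vanishes before any limit. *)
  have -> : sin_integrand a k.+1 =
      fun xs => cos (- (pi / 2) + alt_sum k.+1 xs) / wdenom a k.+1 xs.
    apply/funext => xs; rewrite addrC cosB cos_pihalf sin_pihalf.
    by rewrite mulr0 add0r mulr1.
  rewrite box_int_cos_alt//.
  under eq_Rintegral do rewrite cosN cos_pihalf mulr0.
  by rewrite Rintegral_cst// mul0r.
Unshelve. all: by end_near. Qed.
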